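(* Let $L$, $0<L<\infty$, be the known Lipschitz constant of $f$ on $D$, i.e. $|f(x')-f(x'')|\le L\|x'-x''\|$ for all $x',x''\in D$. Let $D_i=[a_i,b_i]$ be a hyperinterval of a current partition $\{D^k\}$ of $D$, and let $f_i^*$ be the minimum function value over $D_i$, i.e. $f_i^*=f(x_i^* )$, $x_i^*=\arg\min_{x\in D_i}f(x)$. For a finite number $\hat L$ put $$R_i(\hat L)=\tfrac12\bigl(f(a_i)+f(b_i)-\hat L\,\|b_i-a_i\|\bigr).$$ If the overestimate $\hat L$ of $L$ satisfies $$\hat L\ge\sqrt2\,L,$$ then $R_i(\hat L)$ is a lower bound of $f$ over $D_i$, i.e. $R_i(\hat L)\le f_i^*$.
   Context: $D=[a,b]=\{x\in\mathbb{R}^N: a(j)\le x(j)\le b(j),\ 1\le j\le N\}$, where $a,b\in\mathbb{R}^N$ are given; $\|\cdot\|$ is the Euclidean norm; $f:D\to\mathbb{R}$ is the objective function, satisfying the Lipschitz condition on $D$. A hyperinterval $D_i=[a_i,b_i]$ is an axis-parallel box given by the two endpoints $a_i,b_i$ of one of its main diagonals, i.e. $D_i=\{x\in\mathbb{R}^N:\min(a_i(j),b_i(j))\le x(j)\le\max(a_i(j),b_i(j)),\ 1\le j\le N\}$ (the coordinates of $a_i$ need not be smaller than those of $b_i$). A partition $\{D^k\}$ of $D$ is a finite family of hyperintervals $D_i\subseteq D$ whose union is $D$ and any two distinct members of which intersect only along their boundaries. The function $f$ is evaluated at the two vertices $a_i,b_i$ of each $D_i$. *)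

(* Defs.v *)
From HB Require Import structures.
From mathcomp Require Import all_boot all_order all_algebra.
From mathcomp Require Import all_classical all_reals all_analysis.

Set Implicit Arguments.
Unset Strict Implicit.
Unset Printing Implicit Defensive.

Import Order.TTheory GRing.Theory Num.Theory numFieldNormedType.Exports.

Local Open Scope classical_set_scope.
Local Open Scope ring_scope.

(* The library norm `|x| on 'rV[R]_N is the sup norm, hence this definition. *)
Definition enorm (R : realType) (N : nat) (x : 'rV[R]_N) : R :=
  Num.sqrt (\sum_(j < N) x ord0 j ^+ 2).

Definition box (R : realType) (N : nat) (a b : 'rV[R]_N) : set 'rV[R]_N :=
  [set x | forall j : 'I_N, a ord0 j <= x ord0 j <= b ord0 j].

(* The endpoints u, v of the main diagonal are not assumed to be ordered
   coordinatewise. *)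
Definition hyperinterval (R : realType) (N : nat) (u v : 'rV[R]_N) :
    set 'rV[R]_N :=
  [set x | forall j : 'I_N, Num.min (u ord0 j) (v ord0 j) <= x ord0 j
                            <= Num.max (u ord0 j) (v ord0 j)].

Definition boundary (T : topologicalType) (A : set T) : set T :=
  closure A `\` interior A.

(* Distinct members are members with distinct indices; the topology of
   'rV[R]_N is the usual one. *)
Definition hyperinterval_partition (R : realType) (N : nat)
    (D : set 'rV[R]_N) (m : nat) (u v : 'I_m -> 'rV[R]_N) : Prop :=
  [/\ forall i, hyperinterval (u i) (v i) `<=` D,
      \bigcup_i hyperinterval (u i) (v i) = D &
      forall i j, i != j ->
        hyperinterval (u i) (v i) `&` hyperinterval (u j) (v j) `<=`
        boundary (hyperinterval (u i) (v i)) `&`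
        boundary (hyperinterval (u j) (v j))].

(* f is a total function, but only its values on D are constrained. *)
Definition elipschitz_on (R : realType) (N : nat) (D : set 'rV[R]_N)
    (f : 'rV[R]_N -> R) (L : R) : Prop :=
  forall x y, D x -> D y -> `|f x - f y| <= L * enorm (x - y).

Definition is_argmin (R : realType) (T : Type) (A : set T) (f : T -> R)
    (x : T) : Prop :=
  A x /\ forall y, A y -> f x <= f y.

Definition characteristic (R : realType) (N : nat) (f : 'rV[R]_N -> R)
    (u v : 'rV[R]_N) (Lhat : R) : R :=
  2^-1 * (f u + f v - Lhat * enorm (v - u)).

(* Main.v *)
(* For x in the box with main diagonal [u, v], the angle at x of the triangle
   u, x, v is at least right, because (x j - u j) * (x j - v j) <= 0 in every
   coordinate.  Hence |x - u|^2 + |x - v|^2 <= |v - u|^2, and so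
   |x - u| + |x - v| <= sqrt 2 * |v - u|.  Adding the Lipschitz estimates
   f u - f x <= L * |x - u| and f v - f x <= L * |x - v| gives the bound. *)
Require Import Defs.
From HB Require Import structures.
From mathcomp Require Import all_boot all_order all_algebra.
From mathcomp Require Import all_classical all_reals all_analysis.
From mathcomp Require Import ring lra.
Import Order.TTheory GRing.Theory Num.Theory numFieldNormedType.Exports.
Local Open Scope classical_set_scope.
Local Open Scope ring_scope.

Lemma enorm_ge0 {R : realType} {N : nat} (x : 'rV[R]_N) : 0 <= enorm x.
Proof. exact: sqrtr_ge0. Qed.

Lemma sqr_enorm {R : realType} {N : nat} (x : 'rV[R]_N) :
  enorm x ^+ 2 = \sum_(j < N) x ord0 j ^+ 2.
Proof. by rewrite sqr_sqrtr// sumr_ge0// => j _; exact: sqr_ge0. Qed.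

Lemma hyperinterval_left {R : realType} {N : nat} (u v : 'rV[R]_N) :
  hyperinterval u v u.
Proof. by move=> j; rewrite ge_min le_max lexx. Qed.

Lemma hyperinterval_right {R : realType} {N : nat} (u v : 'rV[R]_N) :
  hyperinterval u v v.
Proof. by move=> j; rewrite ge_min le_max lexx !orbT. Qed.

Lemma hyperinterval_sqr_enorm_le {R : realType} {N : nat} {u v x : 'rV[R]_N} :
  hyperinterval u v x ->
  enorm (u - x) ^+ 2 + enorm (v - x) ^+ 2 <= enorm (v - u) ^+ 2.
Proof.
move=> uvx; rewrite !sqr_enorm -big_split/= ler_sum// => j _; rewrite !mxE.
(* The case split resolves [min] and [max]. With [p = u j - x j] and [q = v j - x j], either order
   of the endpoints gives [p * q <= 0], and [p^2 + q^2 = (q - p)^2 + 2 * p * q]. *)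
have := uvx j; case: (leP (u ord0 j) (v ord0 j)) => _ /andP[? ?]; nra.
Qed.

Lemma hyperinterval_enorm_le {R : realType} {N : nat} {u v x : 'rV[R]_N} :
  hyperinterval u v x ->
  enorm (u - x) + enorm (v - x) <= Num.sqrt 2 * enorm (v - u).
Proof.
move=> /hyperinterval_sqr_enorm_le uvx.
rewrite -ler_sqr ?nnegrE ?addr_ge0 ?mulr_ge0 ?sqrtr_ge0 ?enorm_ge0//.
rewrite exprMn sqr_sqrtr//.
(* For the two distances [s] and [t] from [x] to the endpoints,
   [(s + t)^2 = 2 * (s^2 + t^2) - (s - t)^2]; this is where the factor [sqrt 2] comes from. *)
have := sqr_ge0 (enorm (u - x) - enorm (v - x)); lra.
Qed.

Lemma characteristic_le {R : realType} {N : nat} (f : 'rV[R]_N -> R)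
    (L Lhat : R) (u v x : 'rV[R]_N) :
  0 <= L -> elipschitz_on (hyperinterval u v) f L -> Num.sqrt 2 * L <= Lhat ->
  hyperinterval u v x -> characteristic f u v Lhat <= f x.
Proof.
move=> L_ge0 fL LhatP uvx.
have fu := le_trans (ler_norm _) (fL _ _ (hyperinterval_left u v) uvx).
have fv := le_trans (ler_norm _) (fL _ _ (hyperinterval_right u v) uvx).
(* Both inequalities are multiplied out beforehand, so that [lra] only has to chain them linearly
   through the common product [sqrt 2 * L * enorm (v - u)]. *)
have uxv := ler_wpM2l L_ge0 (hyperinterval_enorm_le uvx).
have := ler_wpM2r (enorm_ge0 (v - u)) LhatP.
rewrite /characteristic; lra.
Qed.

Theorem theorem2p1 (R : realType) (N : nat) (a b : 'rV[R]_N)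
    (f : 'rV[R]_N -> R) (L : R) (L_gt0 : 0 < L)
    (fL : elipschitz_on (box a b) f L)
    (m : nat) (u v : 'I_m -> 'rV[R]_N)
    (uvP : hyperinterval_partition (box a b) u v)
    (i : 'I_m) (Lhat : R) (LhatP : Num.sqrt 2 * L <= Lhat) :
  lbound (f @` hyperinterval (u i) (v i)) (characteristic f (u i) (v i) Lhat)
  /\ forall xstar : 'rV[R]_N,
       is_argmin (hyperinterval (u i) (v i)) f xstar ->
       characteristic f (u i) (v i) Lhat <= f xstar.
Proof.
have [uvD _ _] := uvP.
have fLi : elipschitz_on (hyperinterval (u i) (v i)) f L.
  by move=> x y /uvD Dx /uvD Dy; exact: fL.
(* Both conclusions are instances of this pointwise bound, since a minimiser is itself a point of
   the hyperinterval. *)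
have lb x : hyperinterval (u i) (v i) x ->
    characteristic f (u i) (v i) Lhat <= f x.
  by exact: characteristic_le (ltW L_gt0) fLi LhatP.
by split=> [_ [x uvx <-]|x [uvx _]]; exact: lb.
Qed.
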